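(* Let $K$ be a field of characteristic $0$ with algebraic closure $\overline K$. (Reduced form.) Let $p,q\in K$. The roots in $\overline K$ of $g(y)=y^3+py+q$ are given by $$\sqrt[3]{-\frac q2+\sqrt{\Bigl(\frac p3\Bigr)^3+\Bigl(\frac q2\Bigr)^2}}+\sqrt[3]{-\frac q2-\sqrt{\Bigl(\frac p3\Bigr)^3+\Bigl(\frac q2\Bigr)^2}},$$ where the two square roots are chosen to be the same, and the two cube roots are chosen such that their product is $-p/3$. This gives $3$ choices for the pair of cube roots, which gives the $3$ roots (counted with multiplicity) of $g(y)=0$. (In the exceptional case $p=q=0$, the only root $0$ is counted thrice.) (General form.) Equivalently, let $b,c,d\in K$ and put $p=c-\tfrac13 b^2$, $q=d-\tfrac13 bc+\tfrac2{27}b^3$ and $\Delta=b^2c^2-4c^3-4b^3d+18bcd-27d^2=-4p^3-27q^2$. Then the roots in $\overline K$ of $f(x)=x^3+bx^2+cx+d$ are given by $$-\frac b3+\sqrt[3]{-\frac q2+\sqrt{\Bigl(\frac p3\Bigr)^3+\Bigl(\frac q2\Bigr)^2}}+\sqrt[3]{-\frac q2-\sqrt{\Bigl(\frac p3\Bigr)^3+\Bigl(\frac q2\Bigr)^2}} =-\frac b3+\sqrt[3]{-\frac q2+\sqrt{\frac{-\Delta}{108}}}+\sqrt[3]{-\frac q2-\sqrt{\frac{-\Delta}{108}}},$$ with the same conventions on the choice of square roots and cube roots.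
   Context: Square roots and cube roots are taken in $\overline K$. Explicitly, the formula means: fix $s\in\overline K$ with $s^2=(p/3)^3+(q/2)^2=-\Delta/108$ (either choice of $s$ is allowed); then consider the pairs $(u,v)\in\overline K^2$ with $u^3=-q/2+s$, $v^3=-q/2-s$ and $uv=-p/3$; when $(p,q)\ne(0,0)$ there are three such pairs, and the roots of $g$ are the corresponding values $u+v$ (those of $f$ are $-b/3+u+v$). The quantity $\Delta$ is the discriminant of $f$ and of $g(y)=f(y-b/3)=y^3+py+q$. *)

(* Defs.v *)
From mathcomp Require Import all_boot all_order all_algebra.

Set Implicit Arguments.
Unset Strict Implicit.
Unset Printing Implicit Defensive.

Import GRing.Theory.
Local Open Scope ring_scope.

Definition cardano_pair (L : fieldType) (p q s : L) (w : L * L) : Prop :=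
  [/\ w.1 ^+ 3 = - (q / 2) + s, w.2 ^+ 3 = - (q / 2) - s
    & w.1 * w.2 = - (p / 3)].

(* [ws] lists all admissible pairs of cube roots: they are three distinct pairs,
   except when p = q = 0, where the single pair (0, 0) is repeated thrice. *)
Definition cardano_pairs (L : fieldType) (p q s : L) (ws : 3.-tuple (L * L)) :
    Prop :=
  [/\ forall w, w \in ws <-> cardano_pair p q s w,
      (p, q) <> (0, 0) -> uniq ws
    & (p, q) = (0, 0) -> ws = [tuple of nseq 3 (0, 0)]].

(* Main.v *)
Require Import Defs.
From mathcomp Require Import all_boot all_order all_algebra.
From mathcomp Require Import ring.

Set Implicit Arguments.
Unset Strict Implicit.
Unset Printing Implicit Defensive.

Import GRing.Theory.
Local Open Scope ring_scope.

(** The substitution y = u + v is explained by the identity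
    y^3 - 3uv y - (u^3 + v^3)
      = (y - (u + v)) (y - (w u + w^2 v)) (y - (w^2 u + w v)),
    valid whenever w^2 + w + 1 = 0 ([cardano_factorization]).  Hence a pair
    (u, v) with 3uv = -p and u^3 + v^3 = -q splits y^3 + py + q, and the three
    roots come from the three pairs (u, v), (w u, w^2 v), (w^2 u, w v).

    An admissible pair exists ([cardano_pair_exists]) because the two radicands
    -q/2 + s and -q/2 - s have product (-p/3)^3, so that v can be obtained from
    u by division.  All other admissible pairs are obtained from it by the
    action of w ([cardano_pair_orbit]): the same identity with v = 0 says that
    two elements with the same cube differ by a power of w.  In characteristic
    other than 3 we have w != 1, so the action is free away from (0, 0), and
    (0, 0) is admissible only when p = q = 0.

    The general cubic is the reduced one evaluated at x + b/3, so the identity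
    is applied to y = 'X + b/3. *)

Lemma cardano_factorization (R : comPzRingType) (w y u v : R) :
  w ^+ 2 + w + 1 = 0 ->
  (y - (u + v)) * (y - (w * u + w ^+ 2 * v)) * (y - (w ^+ 2 * u + w * v))
  = y ^+ 3 - 3 * (u * v) * y - (u ^+ 3 + v ^+ 3).
Proof.
move=> hw.
(* The last factor below is the quotient, by w^2 + w + 1, of the difference of
   the product of the two conjugate factors and its value at a true root w. *)
transitivity (y ^+ 3 - 3 * (u * v) * y - (u ^+ 3 + v ^+ 3)
  + (w ^+ 2 + w + 1) * ((y - (u + v)) *
      (- (u + v) * y + (w - 1) * (u ^+ 2 + v ^+ 2)
       + (w ^+ 2 - w + 1) * (u * v)))); first by ring.
by rewrite hw mul0r addr0.
Qed.

Lemma cube_root_unity_expr3 (R : comPzRingType) (w : R) :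
  w ^+ 2 + w + 1 = 0 -> w ^+ 3 = 1.
Proof.
move=> hw; apply/subr0_eq.
transitivity ((w - 1) * (w ^+ 2 + w + 1)); first by ring.
by rewrite hw mulr0.
Qed.

Lemma eq_cubes (R : idomainType) (w x y : R) :
  w ^+ 2 + w + 1 = 0 -> x ^+ 3 = y ^+ 3 ->
  [\/ x = y, x = w * y | x = w ^+ 2 * y].
Proof.
move=> hw hxy.
have := cardano_factorization x y 0 hw.
have -> : x ^+ 3 - 3 * (y * 0) * x - (y ^+ 3 + 0 ^+ 3) = 0 by rewrite hxy; ring.
rewrite !mulr0 !addr0 => /eqP; rewrite !mulf_eq0 !subr_eq0 -orbA.
by case/or3P=> /eqP; [constructor 1 | constructor 2 | constructor 3].
Qed.

Lemma cube_root_exists (L : closedFieldType) (a : L) : exists u, u ^+ 3 = a.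
Proof.
have [u hu] := @solve_monicpoly L 3 (fun i => if i == 0%N then a else 0) isT.
exists u; rewrite hu !big_ord_recl big_ord0 /=; ring.
Qed.

Lemma cube_root_unity_exists (L : closedFieldType) :
  exists w : L, w ^+ 2 + w + 1 = 0.
Proof.
have [w hw] := @solve_monicpoly L 2 (fun _ => -1) isT.
exists w; rewrite hw !big_ord_recl big_ord0 /=; ring.
Qed.

Definition cardano_orbit (L : fieldType) (w u v : L) : 3.-tuple (L * L) :=
  [tuple (u, v); (w * u, w ^+ 2 * v); (w ^+ 2 * u, w * v)].

Lemma cardano_orbit_uniq (L : fieldType) (w u v : L) :
  3 != 0 :> L -> w ^+ 2 + w + 1 = 0 -> (u, v) != (0, 0) ->
  uniq (cardano_orbit w u v).
Proof.
move=> n3 hw uv0.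
have w1 : w != 1.
  apply: contraNneq n3 => w1; rewrite -hw w1; apply/eqP; ring.
have w3 := cube_root_unity_expr3 hw.
have w0 : w != 0.
  by apply: contraNneq (oner_neq0 L) => w0; rewrite -w3 w0 expr0n.
have w21 : w ^+ 2 != 1.
  by apply: contraNneq w1 => w21; rewrite -w3 exprS w21 mulr1.
have w2w : w ^+ 2 != w.
  by apply: contraNneq w1 => e; apply/eqP/(mulfI w0); rewrite mulr1 -expr2.
(* distinct multipliers can only agree on 0 *)
have sep (a b x : L) : a != b -> a * x = b * x -> x = 0.
  move=> ab /eqP; rewrite -subr_eq0 -mulrBl mulf_eq0 subr_eq0 (negPf ab).
  by move/eqP.
have sep2 (a b a' b' : L) : a != b -> a' != b' ->
    (a * u, a' * v) != (b * u, b' * v).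
  move=> ab ab'; apply: contra uv0 => /eqP[/(sep _ _ _ ab)-> /(sep _ _ _ ab')->].
  exact: eqxx.
rewrite /= !inE negb_or -{1 3}[u]mul1r -{1 3}[v]mul1r.
by rewrite !sep2 // eq_sym.
Qed.

(** Dividing by u is possible unless its cube -q/2 + s vanishes; then p = 0
    and any cube root of the other radicand will do. *)
Lemma cardano_pair_exists (L : closedFieldType) (p q s : L) :
  2 != 0 :> L -> 3 != 0 :> L -> s ^+ 2 = (p / 3) ^+ 3 + (q / 2) ^+ 2 ->
  exists w, cardano_pair p q s w.
Proof.
move=> n2 n3 hs.
have radicands : (- (q / 2) + s) * (- (q / 2) - s) = (- (p / 3)) ^+ 3.
  transitivity ((q / 2) ^+ 2 - s ^+ 2); first by ring.
  by rewrite hs; ring.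
have [u hu] := cube_root_exists (- (q / 2) + s).
have [u0|u0] := eqVneq u 0.
  have [v hv] := cube_root_exists (- (q / 2) - s).
  exists (u, v); split=> //=; rewrite u0 mul0r.
  move: radicands; rewrite -hu u0 expr0n mul0r => /esym/eqP.
  by rewrite expf_eq0 => /eqP.
exists (u, - (p / 3) / u); split=> //=; last by rewrite mulrC divfK.
by rewrite expr_div_n -radicands hu mulrC mulKf // -hu expf_neq0.
Qed.

Lemma cardano_pair_orbit (L : fieldType) (p q s w u v : L) :
  w ^+ 2 + w + 1 = 0 -> cardano_pair p q s (u, v) ->
  forall x, x \in cardano_orbit w u v <-> cardano_pair p q s x.
Proof.
move=> hw [/= hu hv huv] [x y].
have w3 := cube_root_unity_expr3 hw.
have w6 : (w ^+ 2) ^+ 3 = 1 by rewrite exprAC w3 expr1n.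
have ww2 a b : w * a * (w ^+ 2 * b) = a * b.
  by rewrite mulrACA -exprS w3 mul1r.
have w2w a b : w ^+ 2 * a * (w * b) = a * b.
  by rewrite mulrACA -exprSr w3 mul1r.
split.
  rewrite !inE => /or3P[] /eqP[-> ->]; split=> //=;
  by rewrite ?exprMn ?w3 ?w6 ?mul1r ?ww2 ?w2w.
case=> /= hx hy hxy; rewrite -huv in hxy.
rewrite -hu in hx; rewrite -hv in hy; rewrite !inE.
have [u0|u0] := eqVneq u 0.
  (* x = 0 carries no information: the power of w is read off y *)
  have x0 : x = 0 by apply/eqP; move/eqP: hx; rewrite u0 expr0n expf_eq0.
  rewrite x0 u0 !mulr0.
  by case: (eq_cubes hw hy) => ->; rewrite eqxx ?orbT.
case: (eq_cubes hw hx) => xE; rewrite xE in hxy *.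
- by rewrite (mulfI u0 hxy) eqxx.
- have -> : y = w ^+ 2 * v.
    apply: (mulfI u0); rewrite mulrCA -hxy -[LHS]mul1r -w3; ring.
  by rewrite eqxx orbT.
- have -> : y = w * v.
    apply: (mulfI u0); rewrite mulrCA -hxy -[LHS]mul1r -w3; ring.
  by rewrite eqxx !orbT.
Qed.

Lemma cardano_pair_sum (L : fieldType) (p q s : L) (x : L * L) :
  2 != 0 :> L -> cardano_pair p q s x -> x.1 ^+ 3 + x.2 ^+ 3 = - q.
Proof. by move=> n2 [-> -> _]; field. Qed.

Lemma cardano_pair_prod (L : fieldType) (p q s : L) (x : L * L) :
  3 != 0 :> L -> cardano_pair p q s x -> 3 * (x.1 * x.2) = - p.
Proof. by move=> n3 [_ _ ->]; field. Qed.

(** The translation a lets the same statement serve the reduced cubic (a = 0)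
    and the general one (a = -b/3). *)
Lemma cardano_shifted (L : closedFieldType) (p q s : L) :
  2 != 0 :> L -> 3 != 0 :> L -> s ^+ 2 = (p / 3) ^+ 3 + (q / 2) ^+ 2 ->
  exists2 ws : 3.-tuple (L * L), cardano_pairs p q s ws
  & forall a : L, \prod_(x <- ws) ('X - (a + x.1 + x.2)%:P)
      = ('X - a%:P) ^+ 3 + p%:P * ('X - a%:P) + q%:P.
Proof.
move=> n2 n3 hs.
have [w hw] := cube_root_unity_exists L.
have [[u v] huv] := cardano_pair_exists n2 n3 hs.
have hsum := cardano_pair_sum n2 huv; have hprod := cardano_pair_prod n3 huv.
rewrite /= in hsum hprod.
exists (cardano_orbit w u v).
  split.
  - exact: cardano_pair_orbit.
  - move=> pq0; apply: cardano_orbit_uniq => //; apply/eqP => -[u0 v0].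
    apply: pq0; congr (_, _); apply/eqP; rewrite -oppr_eq0.
      by rewrite -hprod u0 mul0r mulr0.
    by rewrite -hsum u0 v0 expr0n addr0.
  - case=> p0 q0.
    have s0 : s = 0.
      by apply/eqP; move/eqP: hs; rewrite p0 q0 !mul0r !expr0n addr0 expf_eq0.
    case: huv => /= /eqP; rewrite q0 s0 mul0r oppr0 addr0 expf_eq0 => /eqP-> /eqP.
    rewrite expf_eq0 => /eqP-> _.
    by apply: val_inj; rewrite /= !mulr0.
move=> a; rewrite !big_cons big_nil /=.
have hwP : w%:P ^+ 2 + w%:P + 1 = 0 :> {poly L}.
  by rewrite -polyC_exp -!polyCD hw.
have := cardano_factorization ('X - a%:P) u%:P v%:P hwP.
have -> : u%:P ^+ 3 + v%:P ^+ 3 = - q%:P :> {poly L}.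
  by rewrite -!polyC_exp -polyCD hsum polyCN.
have -> : 3 * (u%:P * v%:P) = - p%:P :> {poly L}.
  by rewrite -polyCM -polyCN -hprod; ring.
rewrite mulNr !opprK => <-; ring.
Qed.

Theorem theorem2p5 (K : fieldType) (Kbar : closedFieldType)
    (iota : {rmorphism K -> Kbar})
    (char0 : [pchar K] =i pred0)
    (alg : forall x : Kbar, algebraicOver iota x) :
  (forall (p q : K) (s : Kbar),
     s ^+ 2 = iota ((p / 3) ^+ 3 + (q / 2) ^+ 2) ->
     exists2 ws : 3.-tuple (Kbar * Kbar),
       cardano_pairs (iota p) (iota q) s ws
     & map_poly iota ('X^3 + p *: 'X + q%:P)
       = \prod_(w <- ws) ('X - (w.1 + w.2)%:P))
  /\
  (forall b c d : K,
     let p := c - 1 / 3 * b ^+ 2 in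
     let q := d - 1 / 3 * b * c + 2 / 27 * b ^+ 3 in
     let Delta := b ^+ 2 * c ^+ 2 - 4 * c ^+ 3 - 4 * b ^+ 3 * d
                  + 18 * b * c * d - 27 * d ^+ 2 in
     [/\ Delta = - 4 * p ^+ 3 - 27 * q ^+ 2,
         (p / 3) ^+ 3 + (q / 2) ^+ 2 = - Delta / 108
       & forall s : Kbar,
           s ^+ 2 = iota ((p / 3) ^+ 3 + (q / 2) ^+ 2)
           \/ s ^+ 2 = iota (- Delta / 108) ->
           exists2 ws : 3.-tuple (Kbar * Kbar),
             cardano_pairs (iota p) (iota q) s ws
           & map_poly iota ('X^3 + b *: 'X^2 + c *: 'X + d%:P)
             = \prod_(w <- ws) ('X - (- iota b / 3 + w.1 + w.2)%:P)]).
Proof.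
have nK n : prime n -> n%:R != 0 :> K.
  by move=> pn; have := char0 n; rewrite !inE pn /= => ->.
have n2 := nK 2%N isT; have n3 := nK 3%N isT.
have n27 : 27 != 0 :> K.
  have -> : 27 = 3 ^+ 3 :> K by ring.
  by rewrite expf_neq0.
have n108 : 108 != 0 :> K.
  have -> : 108 = 2 ^+ 2 * 3 ^+ 3 :> K by ring.
  by rewrite mulf_neq0 ?expf_neq0.
have n2' : 2 != 0 :> Kbar by rewrite -(rmorph_nat iota) fmorph_eq0.
have n3' : 3 != 0 :> Kbar by rewrite -(rmorph_nat iota) fmorph_eq0.
have sqE (p q : K) (s : Kbar) : s ^+ 2 = iota ((p / 3) ^+ 3 + (q / 2) ^+ 2) ->
    s ^+ 2 = (iota p / 3) ^+ 3 + (iota q / 2) ^+ 2.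
  by rewrite rmorphD !rmorphXn !fmorph_div !rmorph_nat.
have mapE (b c d : K) : map_poly iota ('X^3 + b *: 'X^2 + c *: 'X + d%:P)
    = 'X^3 + (iota b)%:P * 'X^2 + (iota c)%:P * 'X + (iota d)%:P.
  by rewrite !rmorphD /= !map_polyZ /= map_polyC !map_polyXn map_polyX !mul_polyC.
split.
  move=> p q s /sqE hs.
  have [ws hws prodE] := cardano_shifted n2' n3' hs.
  exists ws => //; have := mapE 0 p q; rewrite scale0r addr0 => ->.
  have -> : \prod_(x <- ws) ('X - (x.1 + x.2)%:P)
      = \prod_(x <- ws) ('X - (0 + x.1 + x.2)%:P).
    by apply: eq_bigr => x _; rewrite add0r.
  by rewrite prodE rmorph0 polyC0 subr0 mul0r addr0.
move=> b c d p q Delta.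
have DeltaE : (p / 3) ^+ 3 + (q / 2) ^+ 2 = - Delta / 108.
  by rewrite /p /q /Delta; field; rewrite n2 n3 n27 n108.
split=> //; first by rewrite /p /q /Delta; field; rewrite n3 n27.
move=> s hs.
have {}hs : s ^+ 2 = iota ((p / 3) ^+ 3 + (q / 2) ^+ 2).
  by case: hs => ->; rewrite ?DeltaE.
have [ws hws prodE] := cardano_shifted n2' n3' (sqE _ _ _ hs).
exists ws => //; rewrite mapE prodE.
(* with b = 3t every coefficient is an integral polynomial in t, c and d *)
pose t : K := b / 3.
have bE : b = 3 * t by rewrite /t; field.
have pE : p = c - 3 * t ^+ 2 by rewrite /p bE; field.
have qE : q = d - t * c + 2 * t ^+ 3 by rewrite /q bE; field; rewrite n3 n27.
have -> : - iota b / 3 = - iota t by rewrite mulNr /t fmorph_div rmorph_nat.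
rewrite pE qE bE; ring.
Qed.
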